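(* Let $T$ be a skew tract endowed with an involution $x\mapsto\overline x$, let $N$ be a matroid on a non-empty finite set $E$, let $\mathcal{C}$ be a left $T$-signature of $N$, and let $\mathcal{D}$ be a right $T$-signature of $N^*$. Then $\mathcal{C}$ and $\mathcal{D}$ are the sets of $T$-circuits and $T$-cocircuits, respectively, of a weak left $T$-matroid with underlying matroid $N$ if and only if $(\mathcal{C},\mathcal{D})$ forms a weak dual pair of $T$-signatures of $N$, i.e. $\mathcal{C}\perp_3\mathcal{D}$.
   Context: **Skew tracts.** A skew tract $T$ is a group $G$ (written multiplicatively, identity $1$) together with a subset $N_G$ of the group semiring $\mathbb{N}[G]$ such that: (1) $0\in N_G$; (2) $1\notin N_G$; (3) there is a unique $\epsilon\in G$ with $1+\epsilon\in N_G$; (4) $N_G$ is closed under the left and right actions of $G$ on $\mathbb{N}[G]$. Write $T=G\cup\{0\}$, $T^\times=G$, where $0$ is identified with the zero of $\mathbb{N}[G]$ and is absorbing for multiplication; $-x:=\epsilon x$ (one has $\epsilon x=x\epsilon$ and $\epsilon^2=1$). An involution of $T$ is a map $x\mapsto\overline x$ from $T$ to $T$ with $\overline 0=0$, that is a monoid homomorphism $(T,\cdot,1)\to(T,\cdot,1)$, preserves addition (its additive extension to $\mathbb{N}[G]$ maps $N_G$ into $N_G$), and has square the identity. $T^E$ is the set of functions $E\to T$, with coordinatewise left and right multiplication by $T$. The support of $X\in T^E$ is $\underline{X}=\{e\in E: X(e)\neq 0\}$; for $S\subseteq T^E$, $\underline{S}$ is the set of supports of elements of $S$. **Orthogonality.**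 $X\perp Y$ means $X\cdot Y:=\sum_{e\in E}X(e)\overline{Y(e)}\in N_G$; $\mathcal{C}\perp_k\mathcal{D}$ means $X\perp Y$ for all $X\in\mathcal{C}$, $Y\in\mathcal{D}$ with $|\underline X\cap\underline Y|\le k$. **Modular pairs.** For a collection $C$ of pairwise incomparable non-empty subsets of $E$, $U(C)=\{\bigcup S: S\subseteq C\}$ is a lattice under inclusion (join is union). Two distinct members of $C$ form a modular pair if their union has height $2$ in $U(C)$. $X,Y\in\mathcal{C}\subseteq T^E$ form a modular pair if $\underline X,\underline Y$ form a modular pair in $\underline{\mathcal{C}}$. **Weak $T$-matroids.** $\mathcal{C}\subseteq T^E$ is the $T$-circuit set of a weak left $T$-matroid $\mathcal{M}=(E,\mathcal{C})$ on $E$ if: (C1) $0\notin\mathcal{C}$; (C2) $X\in\mathcal{C}$, $\alpha\in T^\times$ imply $\alpha X\in\mathcal{C}$; (C3) if $X,Y\in\mathcal{C}$ and $\underline X\subseteq\underline Y$ then $Y=\alpha X$ for some $\alpha\in T^\times$; (C4) if $X,Y\in\mathcal{C}$ form a modular pair and $e\in E$ satisfies $X(e)=-Y(e)\ne0$, there is $Z\in\mathcal{C}$ with $Z(e)=0$ and $X(f)+Y(f)-Z(f)\in N_G$ for all $f\in E$. The underlying matroid $\underline{\mathcal{M}}$ is the matroid on $E$ whose circuits are the supports of the elements of $\mathcal{C}$. **Signatures.** A left $T$-signature of a matroid $N$ is a set $\mathcal{C}\subseteq T^E$ satisfying (C1), (C2), (C3) such that $\underline{\mathcal{C}}$ is the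 set of circuits of $N$. Right $T$-signatures are defined likewise with $X\alpha$ in place of $\alpha X$ in (C2), (C3). $(\mathcal{C},\mathcal{D})$ is a weak dual pair of $T$-signatures of $N$ if $\mathcal{C}$ is a left $T$-signature of $N$, $\mathcal{D}$ is a right $T$-signature of the dual matroid $N^*$, and $\mathcal{C}\perp_3\mathcal{D}$. **Cocircuits.** $A_N$ is the set of ordered pairs $(B,B')$ of bases of $N$ with $|B\setminus B'|=1$; $Fab=F\cup\{a,b\}$ etc. For a left $T$-matroid $\mathcal{M}$ with $T$-circuit set $\mathcal{C}$ and underlying matroid $N$, let $[Fa,Fb]_{\mathcal{C}}:=-X(a)^{-1}X(b)$ for any $X\in\mathcal{C}$ with $a,b\in\underline X\subseteq Fab$ (well defined on $A_N$), and let $[B,B']^*:=-\overline{[E\setminus B,E\setminus B']_{\mathcal{C}}}$ for $(B,B')\in A_{N^*}$. The set of $T$-cocircuits of $\mathcal{M}$ is the $T$-circuit set of the dual right $T$-matroid $\mathcal{M}^*$ (the one with quasi-Plücker coordinates $[\cdot]^*$), namely $\{Y\in T^E:\underline Y$ is a circuit of $N^*$ and $Y(b)Y(a)^{-1}=-[Fa,Fb]^*$ whenever $a,b\in\underline Y\subseteq Fab$ with $(Fa,Fb)\in A_{N^*}\}$. *)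

(* Defs.v *)
From HB Require Import structures.
From mathcomp Require Import all_classical finmap multiset.
From mathcomp Require Import all_boot.

Set Implicit Arguments.
Unset Strict Implicit.
Unset Printing Implicit Defensive.

Declare Scope tract_scope.
Delimit Scope tract_scope with T.
Local Open Scope mset_scope.
Local Open Scope nat_scope.
Local Open Scope group_scope.
Local Open Scope tract_scope.

(* Elements of the group semiring N[G] are finitely supported functions       *)
(* G -> nat, i.e. finite multisets; the sum is msetD, the zero is mset0.      *)

Definition lact (G : groupType) (g : G) (A : {mset G}) : {mset G} :=
  seq_mset [seq g * x | x <- enum_mset A].

Definition ract (G : groupType) (A : {mset G}) (g : G) : {mset G} :=
  seq_mset [seq x * g | x <- enum_mset A].

Record skewTract := SkewTract {
  tgroup : groupType;
  null : set {mset tgroup};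
  teps : tgroup;
  null0 : null mset0;
  null1 : ~ null [mset 1];
  null_eps : null (1 +` [mset teps]);
  null_eps_unique : forall g : tgroup, null (1 +` [mset g]) -> g = teps;
  null_lact : forall (g : tgroup) A, null A -> null (lact g A);
  null_ract : forall (g : tgroup) A, null A -> null (ract A g)
}.

(* T = G u {0}, with None as 0. *)
Definition tract_carrier (T : skewTract) : Type := option (tgroup T).
Coercion tract_carrier : skewTract >-> Sortclass.

Section Carrier.
Variable T : skewTract.
Implicit Types x y : T.

Definition tzero : T := None.

Definition tone : T := Some 1.

Definition tmul x y : T :=
  match x, y with
  | Some g, Some h => Some (g * h)
  | _, _ => None
  end.

(* 0^-1 = 0 by convention. *)
Definition tinv x : T := if x is Some g then Some g^-1 else None.

Fact tmulA : associative tmul.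
Proof. by case=> [a|] [b|] [c|] //=; rewrite mulgA. Qed.

Fact tmul1 : left_id tone tmul.
Proof. by case=> [a|] //=; rewrite mul1g. Qed.

Fact tinvK : involutive tinv.
Proof. by case=> [a|] //=; rewrite invgK. Qed.

Fact tinvM : {morph tinv : x y / tmul x y >-> tmul y x}.
Proof. by case=> [a|] [b|] //=; rewrite invgM. Qed.

HB.instance Definition _ := Choice.copy (tract_carrier T) (option (tgroup T)).
HB.instance Definition _ :=
  isStarMonoid.Build (tract_carrier T) tmulA tmul1 tinvK tinvM.

Definition topp x : T := (Some (teps T) : T) * x.

Definition to_semiring x : {mset (tgroup T)} :=
  if x is Some g then [mset g] else mset0.

(* Additive extension of f to N[G], with 0 in T sent to the zero of N[G]. *)
Definition extend (f : T -> T) (A : {mset (tgroup T)}) : {mset (tgroup T)} :=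
  \big[msetD/mset0]_(g <- enum_mset A) to_semiring (f (Some g)).

End Carrier.

Notation "0" := (tzero _) : tract_scope.
Notation "- x" := (topp x) : tract_scope.

Record involution (T : skewTract) := Involution {
  bar :> T -> T;
  bar0 : bar 0 = 0;
  bar_monoid : monoid_morphism bar;
  bar_null : forall A, null A -> null (extend bar A);
  barK : involutive bar
}.

Record matroid (E : finType) := Matroid {
  bases : {set {set E}};
  bases_neq0 : bases != set0;
  bases_exchange : forall B1 B2, B1 \in bases -> B2 \in bases ->
    forall x, x \in B1 :\: B2 ->
    exists2 y, y \in B2 :\: B1 & y |: (B1 :\ x) \in bases
}.

Section Matroid.
Variables (E : finType) (N : matroid E).

Definition independent (S : {set E}) : bool :=
  [exists B in bases N, S \subset B].

Definition circuits : {set {set E}} :=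
  [set S | minset (fun A => ~~ independent A) S].

Definition adjacent_bases : {set {set E} * {set E}} :=
  [set p | [&& p.1 \in bases N, p.2 \in bases N & #|p.1 :\: p.2| == 1%N]].

Definition dual_bases : {set {set E}} := [set ~: B | B in bases N].

Fact dual_bases_neq0 : dual_bases != set0.
Proof.
have /set0Pn[B BN] := bases_neq0 N.
by apply/set0Pn; exists (~: B); apply: imset_f.
Qed.

Fact bases_coexchange B1 B2 : B1 \in bases N -> B2 \in bases N ->
  forall x, x \in B2 :\: B1 ->
  exists2 y, y \in B1 :\: B2 & x |: (B1 :\ y) \in bases N.
Proof.
move=> B1N; have [n] := ubnP #|B2 :\: B1|; elim: n B2 => // n IHn B2 leB2 B2N x.
move=> xB21; have := xB21; rewrite inE => /andP[xB1 xB2].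
have [z|noz] := pickP [pred z | (z \in B2 :\: B1) && (z != x)].
  move=> /andP[zB21 zx]; have := zB21; rewrite inE => /andP[zB1 zB2].
  have [w] := bases_exchange B2N B1N zB21; rewrite inE => /andP[wB2 wB1] B3N.
  have [||y] := IHn _ _ B3N x.
  - apply: leq_trans (_ : _ < #|B2 :\: B1|) leB2.
    apply/proper_card/properP; split.
      apply/subsetP=> u; rewrite !inE => /andP[uB1].
      by case: eqP uB1 => [->|_ uB1 /andP[_ ->]]; rewrite ?wB1 // uB1.
    exists z => //; rewrite !inE eqxx orbF zB1 /=.
    by apply: contraNneq zB1 => ->.
  - by rewrite !inE xB1 xB2 [x == z]eq_sym zx orbT.
  rewrite !inE negb_or negb_and negbK => /andP[/andP[yw yB2] yB1] B4N.
  exists y => //; rewrite !inE yB1 andbT.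
  by case/orP: yB2 => // /eqP yz; rewrite -yz yB1 in zB1.
have [y yB12 _] := bases_exchange B2N B1N xB21.
exists y => //; have [w wB21] := bases_exchange B1N B2N yB12.
by have := noz w; rewrite /= wB21 => /negbFE/eqP ->.
Qed.

Fact dual_bases_exchange B1 B2 : B1 \in dual_bases -> B2 \in dual_bases ->
  forall x, x \in B1 :\: B2 ->
  exists2 y, y \in B2 :\: B1 & y |: (B1 :\ x) \in dual_bases.
Proof.
move=> /imsetP[A1 A1N ->] /imsetP[A2 A2N ->] x.
rewrite !inE negbK => /andP[xA2 xA1].
have [|y] := bases_coexchange A1N A2N (x := x); first by rewrite inE xA1.
rewrite inE => /andP[yA2 yA1] A3N; exists y; first by rewrite !inE yA1 yA2.
apply/imsetP; exists (x |: (A1 :\ y)) => //; apply/setP=> u; rewrite !inE.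
have yx : (y == x) = false by apply: contraTF yA1 => /eqP->.
have [->|_] := eqVneq u y; first by rewrite yx.
by rewrite negb_or.
Qed.

Definition dual : matroid E := Matroid dual_bases_neq0 dual_bases_exchange.

End Matroid.

Section ModularPairs.
Variable E : finType.
Implicit Types (U K C : {set {set E}}) (A B : {set E}).

Definition unions C : {set {set E}} :=
  [set cover S | S : {set {set E}} in powerset C].

Definition is_chain K : bool :=
  [forall A in K, forall B in K, (A \subset B) || (B \subset A)].

(* Length (number of elements minus one) of a longest chain of U below A. *)
Definition height U A : nat :=
  \max_(K : {set {set E}} | is_chain K && (K \subset [set B in U | B \subset A]))
    #|K|.-1.

Definition modular_pair C A B : bool :=
  [&& A \in C, B \in C, A != B & height (unions C) (A :|: B) == 2].

End ModularPairs.

Section TVectors.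
Variables (T : skewTract) (E : finType).
Implicit Types (X Y Z : {ffun E -> T}) (C D : set {ffun E -> T}).

Definition vzero : {ffun E -> T} := [ffun=> 0].
Definition lscale (a : T) X : {ffun E -> T} := [ffun e => a * X e].
Definition rscale X (a : T) : {ffun E -> T} := [ffun e => X e * a].

Definition supp X : {set E} := [set e | X e != 0].

Definition supports C : {set {set E}} :=
  [set S | `[< exists2 X, C X & supp X = S >]].

Definition tmodular_pair C X Y : Prop :=
  [/\ C X, C Y & modular_pair (supports C) (supp X) (supp Y)].

Definition axiomC1 C : Prop := ~ C vzero.

Definition axiomC2l C : Prop :=
  forall X (a : T), C X -> a != 0 -> C (lscale a X).
Definition axiomC2r C : Prop :=
  forall X (a : T), C X -> a != 0 -> C (rscale X a).

Definition axiomC3l C : Prop :=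
  forall X Y, C X -> C Y -> supp X \subset supp Y ->
  exists2 a : T, a != 0 & Y = lscale a X.
Definition axiomC3r C : Prop :=
  forall X Y, C X -> C Y -> supp X \subset supp Y ->
  exists2 a : T, a != 0 & Y = rscale X a.

Definition axiomC4 C : Prop :=
  forall X Y e, tmodular_pair C X Y -> X e = - Y e -> X e != 0 ->
  exists Z, [/\ C Z, Z e = 0 &
    forall f, null (to_semiring (X f) `+` to_semiring (Y f)
                    `+` to_semiring (- Z f))].

Record weakLeftMatroid := WeakLeftMatroid {
  tcircuits : set {ffun E -> T};
  tcircuitsC1 : axiomC1 tcircuits;
  tcircuitsC2 : axiomC2l tcircuits;
  tcircuitsC3 : axiomC3l tcircuits;
  tcircuitsC4 : axiomC4 tcircuits
}.

Definition has_underlying_matroid (M : weakLeftMatroid) (N : matroid E) : Prop :=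
  supports (tcircuits M) = circuits N.

Definition left_signature (N : matroid E) C : Prop :=
  [/\ axiomC1 C, axiomC2l C, axiomC3l C & supports C = circuits N].

Definition right_signature (N : matroid E) C : Prop :=
  [/\ axiomC1 C, axiomC2r C, axiomC3r C & supports C = circuits N].

Variable i : involution T.

Definition dotprod X Y : {mset (tgroup T)} :=
  \big[msetD/mset0]_(e : E) to_semiring (X e * i (Y e)).

Definition orthogonal X Y : Prop := null (dotprod X Y).

Definition orthogonal_upto (k : nat) C D : Prop :=
  forall X Y, C X -> D Y -> #|supp X :&: supp Y| <= k -> orthogonal X Y.

Definition weak_dual_pair (N : matroid E) C D : Prop :=
  [/\ left_signature N C, right_signature (dual N) D & orthogonal_upto 3 C D].

(* [Fa, Fb]_C = - X(a)^-1 X(b): a value of this expression, which does not    *)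
(* depend on X, a, b when (Fa, Fb) is in A_N for N the underlying matroid.    *)
Definition quasi_plucker C (B B' : {set E}) : T :=
  xget 0 [set t : T | exists F a b X,
    [/\ B = a |: F, B' = b |: F, C X,
        [&& a \in supp X, b \in supp X & supp X \subset a |: (b |: F)]
      & t = - ((X a)^-1 * X b)]]%classic.

Definition dual_quasi_plucker C (B B' : {set E}) : T :=
  - i (quasi_plucker C (~: B) (~: B')).

Definition tcocircuits (M : weakLeftMatroid) (N : matroid E) :
    set {ffun E -> T} :=
  [set Y | supp Y \in circuits (dual N) /\
    forall F a b, (a |: F, b |: F) \in adjacent_bases (dual N) ->
      a \in supp Y -> b \in supp Y -> supp Y \subset a |: (b |: F) ->
      Y b * (Y a)^-1 =
        - dual_quasi_plucker (tcircuits M) (a |: F) (b |: F)]%classic.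

End TVectors.

(* Main.v *)
(* Orthogonality of a circuit and a cocircuit with two common elements is the *)
(* condition defining T-cocircuits, so the content lies in three common       *)
(* elements.  If C satisfies (C4) and X in C meets the cocircuit Y in         *)
(* {e, f, g}, take a basis B containing X minus {f, g} with B :&: Y = {e}; the *)
(* fundamental circuits U of f and W of g form a modular pair whose union has *)
(* nullity 2, they share some p outside X, and X is the only circuit in the   *)
(* union avoiding p.  Eliminating p by (C4) expresses X through U and W, and  *)
(* the orthogonalities of U and W with Y add up to that of X with Y.          *)
(* Conversely, if X, Y is a modular pair, then for all f in X minus Y, h in   *)
(* Y minus X and g in both, some cocircuit meets the union of the supports    *)
(* exactly in {f, g, h}; orthogonality to these cocircuits forces the only    *)
(* circuit Z avoiding e, suitably scaled, to satisfy (C4).                    *)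
From HB Require Import structures.
Require Import Defs.
From mathcomp Require Import all_classical finmap multiset.
From mathcomp Require Import all_boot.

Set Implicit Arguments.
Unset Strict Implicit.
Unset Printing Implicit Defensive.

(** Read through the involution, the ratios Y(b) Y(a)^-1 that define a T-cocircuit are the
    orthogonality relations of Y with circuits meeting it in {a, b} ([cross_ratio_dual],
    [dual_quasi_plucker_orthogonal]). Every two-element intersection of a circuit and a cocircuit
    arises from adjacent dual bases, so T-circuits and T-cocircuits are orthogonal there
    ([tcocircuit_orthogonal2]). Conversely, orthogonality up to 2 puts D inside the T-cocircuits
    ([right_signature_sub_tcocircuits]), and the inclusion is an equality because the ratios
    determine a vector on its support up to right scaling ([tcocircuits_sub]).

    One-element intersections do not occur ([circuit_cocircuit_neq1]). What remains is to pass from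
    (C4) to intersections of size three ([axiomC4_orthogonal3]) and from orthogonality up to 3 back
    to (C4) ([orthogonal3_axiomC4]).

    Modular pairs are controlled by chains. Nullity increases strictly along unions of circuits and
    so bounds the height: nullity at most 2 certifies modular pairs ([modular_pair_nullity]) and
    limits the circuits in a union ([circuit_subU_nullity]). In the other direction, height 2
    determines circuits that avoid certain elements ([modular_pair_circuit]), which yields the test
    cocircuits of [modular_pair_cocircuit]. *)

Section MatroidTheory.
Variable E : finType.
Implicit Types (N : matroid E) (A B I Q S X Y : {set E}).

(** * Bases, independent sets and circuits *)

Lemma card_bases N B1 B2 :
  B1 \in bases N -> B2 \in bases N -> #|B1| = #|B2|.
Proof.
have [n] := ubnP #|B1 :\: B2|; elim: n B1 => // n IHn B1 leB1 B1N B2N.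
have [/eqP|[x xB12]] := set_0Vmem (B1 :\: B2).
  rewrite setD_eq0 => sB12; congr #|pred_of_set _|; apply/eqP.
  rewrite eqEsubset sB12 /=; apply/subsetP => x xB2; apply/negPn/negP => xB1.
  have [|y] := bases_exchange B2N B1N (x := x); first by rewrite inE xB1.
  by rewrite inE => /andP[/negP yB2 /(subsetP sB12)].
have [y] := bases_exchange B1N B2N xB12.
move: xB12; rewrite !inE => /andP[xB2 xB1] /andP[yB1 yB2] B3N.
rewrite -(IHn _ _ B3N B2N); first last.
  rewrite -ltnS; apply: leq_trans leB1; rewrite ltnS; apply/proper_card/properP; split.
    apply/subsetP => u; rewrite !inE => /andP[uB2 /orP[/eqP uy|/andP[_ ->]]].
      by rewrite uy yB2 in uB2.
    by rewrite uB2.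
  exists x; first by rewrite inE xB1 xB2.
  by rewrite !inE eqxx xB2 orbF /=; apply: contraNneq xB2 => ->.
by rewrite cardsU1 [#|B1|](cardsD1 x) xB1 !inE (negPf yB1) andbF.
Qed.

Lemma basis_sub_eq N B1 B2 :
  B1 \in bases N -> B2 \in bases N -> B1 \subset B2 -> B1 = B2.
Proof.
by move=> B1N B2N sB; apply/eqP; rewrite eqEcard sB (card_bases B1N B2N) /=.
Qed.

Lemma independentP N I :
  reflect (exists2 B, B \in bases N & I \subset B) (independent N I).
Proof. exact: exists_inP. Qed.

Lemma independentS N A I : A \subset I -> independent N I -> independent N A.
Proof.
move=> sAI /independentP[B BN sIB].
by apply/independentP; exists B => //; apply: subset_trans sIB.
Qed.

(** Start from a basis above [I]; each of its elements outside [S] is exchanged for one of [B0],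
    which lies in [S], and no element of [I] is ever removed. *)
Lemma basis_between N I S B0 :
  independent N I -> I \subset S -> B0 \in bases N -> B0 \subset S ->
  exists B, [/\ B \in bases N, I \subset B & B \subset S].
Proof.
move=> /independentP[B BN sIB] sIS B0N sB0S.
have [n] := ubnP #|B :\: S|; elim: n B BN sIB => // n IHn B BN sIB leB.
have [/eqP|[x]] := set_0Vmem (B :\: S); first by rewrite setD_eq0; exists B.
rewrite inE => /andP[xS xB].
have [|y] := bases_exchange BN B0N (x := x).
  by rewrite inE xB andbT; apply: contra xS; apply/subsetP.
rewrite inE => /andP[yB /(subsetP sB0S) yS] B'N.
apply: IHn B'N _ _.
  apply/subsetP => u uI; rewrite !inE (subsetP sIB _ uI) andbT orbC.
  by rewrite (contraNneq _ xS) // => <-; apply: subsetP uI.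
rewrite -ltnS; apply: leq_trans leB; rewrite ltnS; apply/proper_card/properP; split.
  apply/subsetP => u; rewrite !inE => /andP[uS /orP[/eqP uy|/andP[_ ->]]].
    by rewrite uy yS in uS.
  by rewrite uS.
exists x; first by rewrite inE xS.
by rewrite !inE eqxx orbF xS /=; apply: contraNneq xS => ->.
Qed.

Lemma circuit_independent N Q I :
  Q \in circuits N -> independent N I -> ~~ (Q \subset I).
Proof.
rewrite inE => /minsetp depQ indI.
by apply: contra depQ => /independentS; apply.
Qed.

Lemma circuit_eq N Q1 Q2 :
  Q1 \in circuits N -> Q2 \in circuits N -> Q1 \subset Q2 -> Q1 = Q2.
Proof.
by rewrite !inE => /minsetp depQ1 minQ2; apply: (minsetinf minQ2).
Qed.

Lemma circuitD1 N Q q : Q \in circuits N -> q \in Q -> independent N (Q :\ q).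
Proof.
rewrite inE => minQ qQ; apply: contraT => depQ.
have /setP/(_ q) := minsetinf minQ depQ (subsetDl _ _).
by rewrite qQ !inE eqxx.
Qed.

Lemma dependent_circuit N A :
  ~~ independent N A -> exists2 Q, Q \in circuits N & Q \subset A.
Proof.
move=> depA.
have [Q minQ sQA] := @minset_exists _ (fun S => ~~ independent N S) A depA.
by exists Q; rewrite ?inE.
Qed.

Lemma circuit_neq0 N Q : Q \in circuits N -> Q != set0.
Proof.
move=> QC; have /set0Pn[B BN] := bases_neq0 N.
have indB : independent N B by apply/independentP; exists B.
by apply: contraNneq (circuit_independent QC indB) => ->; apply: sub0set.
Qed.

Lemma basis_independent N B : B \in bases N -> independent N B.
Proof. by move=> BN; apply/independentP; exists B. Qed.

(** [Q :\ q] extends to a basis inside [x |: B]. That basis omits [q], as it cannot contain [Q], and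
    by cardinality it omits nothing else. *)
Lemma circuit_exchange N B Q x q :
  B \in bases N -> x \notin B -> Q \in circuits N -> Q \subset x |: B ->
  q \in Q -> (x |: B) :\ q \in bases N.
Proof.
move=> BN xB QC sQ qQ.
have [B' [B'N sQB' sB']] : exists B', [/\ B' \in bases N, Q :\ q \subset B'
    & B' \subset x |: B].
  apply: basis_between (circuitD1 QC qQ) _ BN (subsetUr _ _).
  by apply: subset_trans sQ; apply: subsetDl.
have qB' : q \notin B'.
  have := circuit_independent QC (basis_independent B'N).
  apply: contra => qB'; apply/subsetP => u uQ.
  by have [->//|uq] := eqVneq u q; apply: (subsetP sQB'); rewrite !inE uq.
suff -> : (x |: B) :\ q = B' by [].
apply/esym/eqP; rewrite eqEcard subsetD1 sB' qB' /= (card_bases B'N BN).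
have := cardsD1 q (x |: B); rewrite (subsetP sQ _ qQ) cardsU1 xB.
by rewrite !add1n => -[->].
Qed.

(** An element [q] of [Q1] outside [Q2] would put [Q2] inside the basis [(x |: B) :\ q]. *)
Lemma fundamental_circuit_unique N B Q1 Q2 x :
  B \in bases N -> Q1 \in circuits N -> Q2 \in circuits N ->
  Q1 \subset x |: B -> Q2 \subset x |: B -> Q1 = Q2.
Proof.
move=> BN Q1C Q2C s1 s2; apply: (circuit_eq Q1C Q2C); apply/subsetP => q qQ1.
have [xB|xB] := boolP (x \in B).
  have := circuit_independent Q1C (basis_independent BN).
  by rewrite (setUidPr _) ?sub1set // in s1; rewrite s1.
have := circuit_exchange BN xB Q1C s1 qQ1 => /basis_independent.
by move/(circuit_independent Q2C); apply: contraR => qQ2; rewrite subsetD1 s2.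
Qed.

Lemma fundamental_circuit N B x : B \in bases N -> x \notin B ->
  exists Q, [/\ Q \in circuits N, Q \subset x |: B & x \in Q].
Proof.
move=> BN xB; have /dependent_circuit[Q QC sQ] : ~~ independent N (x |: B).
  apply/independentP => -[B' B'N sB'].
  have /setP/(_ x) := basis_sub_eq BN B'N (subset_trans (subsetUr _ _) sB').
  by rewrite (negPf xB) (subsetP sB') // setU11.
exists Q; split=> //.
have := circuit_independent QC (basis_independent BN).
by apply: contraR => xQ; rewrite -(setU1K xB) subsetD1 sQ.
Qed.

Lemma circuit_elimination N X Y e :
  X \in circuits N -> Y \in circuits N -> X != Y -> e \in X ->
  exists2 Z, Z \in circuits N & Z \subset (X :|: Y) :\ e.
Proof.
move=> XC YC neqXY eX; apply/dependent_circuit/independentP => -[B BN sB].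
have sXY : X :|: Y \subset e |: B.
  apply/subsetP => u uXY; rewrite !inE -implyNb; apply/implyP => ue.
  by apply: (subsetP sB); rewrite in_setD1 ue.
case/eqP: neqXY; apply: fundamental_circuit_unique BN XC YC _ _.
  exact: subset_trans (subsetUl _ _) sXY.
exact: subset_trans (subsetUr _ _) sXY.
Qed.

(** * Circuits against cocircuits *)

Lemma in_dual_bases N B : (B \in bases (dual N)) = (~: B \in bases N).
Proof.
apply/imsetP/idP => [[A AN ->]|BN]; first by rewrite setCK.
by exists (~: B) => //; rewrite setCK.
Qed.

(** A dual basis above [Y :\ a] is the complement of a basis avoiding [Y :\ a], so [I] extends to a
    basis avoiding it too. A cocircuit meets every basis, so this one contains [a]. *)
Lemma cocircuit_basis N I Y a :
  independent N I -> Y \in circuits (dual N) -> a \in Y ->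
  I :&: Y \subset [set a] ->
  exists B, [/\ B \in bases N, I \subset B & B :&: Y = [set a]].
Proof.
move=> indI YC aY sIY.
have /independentP[A] := circuitD1 YC aY; rewrite in_dual_bases => AN sYA.
have [||B [BN sIB sB]] := basis_between indI (S := ~: (Y :\ a)) _ AN.
- apply/subsetP => u uI; rewrite !inE negb_and negbK orbC -implybE.
  by apply/implyP => uY; rewrite -in_set1 (subsetP sIY) // inE uI.
- by rewrite setCS.
exists B; split=> //; apply/eqP; rewrite eqEsubset; apply/andP; split.
  apply/subsetP => u /setIP[/(subsetP sB)]; rewrite !inE => + uY.
  by rewrite uY andbT negbK.
have /set0Pn[u /setIP[uB uY]] : B :&: Y != set0.
  rewrite setI_eq0 disjoint_sym disjoints_subset.
  by apply: circuit_independent YC (basis_independent _); rewrite in_dual_bases setCK.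
rewrite sub1set; have /subsetP/(_ _ uB) := sB.
by rewrite !inE uY andbT negbK => /eqP <-; rewrite uB.
Qed.

(** Otherwise [X :\ a] would extend to a basis meeting [Y] in [a], and this basis would contain
    [X]. *)
Lemma circuit_cocircuit_neq1 N X Y a :
  X \in circuits N -> Y \in circuits (dual N) -> X :&: Y != [set a].
Proof.
move=> XC YC; apply/eqP => XYa.
have /setIP[aX aY] : a \in X :&: Y by rewrite XYa set11.
have [|B [BN sXB BYa]] := cocircuit_basis (circuitD1 XC aX) YC aY.
  by rewrite -XYa setSI // subsetDl.
have /setIP[aB _] : a \in B :&: Y by rewrite BYa set11.
have /negP[] := circuit_independent XC (basis_independent BN).
by rewrite -(setD1K aX) subUset sub1set aB.
Qed.

(** * Nullity and height of unions of circuits *)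

Definition nullity N A : nat := #|A| - \max_(B in bases N) #|A :&: B|.

Lemma nullity_leq N A B : B \in bases N -> nullity N A <= #|A :\: B|.
Proof.
move=> BN; rewrite cardsD leq_sub2l //.
exact: (@leq_bigmax_cond _ _ (fun B => #|A :&: B|)).
Qed.

(** Let [B] be a basis with the largest trace on [A]. A basis between [I] and [A :|: B] has at most
    [#|B :\: A|] elements outside [A], so its trace on [A] is also largest. *)
Lemma nullity_attained N I A : independent N I -> I \subset A ->
  exists B, [/\ B \in bases N, I \subset B & nullity N A = #|A :\: B|].
Proof.
move=> indI sIA; have := bases_neq0 N; rewrite -card_gt0.
case/(eq_bigmax_cond (fun B => #|A :&: B|)) => B BN maxE.
have [||B' [B'N sIB' sB']] := basis_between indI (S := A :|: B) _ BN.
- exact: subset_trans (subsetUl _ _).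
- exact: subsetUr.
exists B'; split=> //; apply/eqP; rewrite eqn_leq nullity_leq //=.
rewrite /nullity maxE cardsD leq_sub2l // -(leq_add2r #|B :\: A|) setIC cardsID.
rewrite -(card_bases B'N BN) -(cardsID A B') [A :&: B']setIC leq_add2l.
apply: subset_leq_card; apply/subsetP => u.
by rewrite !inE => /andP[uA /(subsetP sB')]; rewrite inE (negPf uA).
Qed.

Lemma nullityS N A S : A \subset S -> nullity N A <= nullity N S.
Proof.
have /set0Pn[B0 B0N] := bases_neq0 N.
have ind0 : independent N set0 := independentS (sub0set _) (basis_independent B0N).
have [B [BN _ ->]] := nullity_attained ind0 (sub0set S).
by move=> sAS; rewrite (leq_trans (nullity_leq A BN)) // subset_leq_card // setSD.
Qed.

Lemma unionsP N A :
  reflect (forall x, x \in A -> exists2 Q, Q \in circuits N & x \in Q /\ Q \subset A)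
          (A \in unions (circuits N)).
Proof.
apply: (iffP imsetP) => [[S + ->] x /bigcupP[Q QS xQ]|exQ].
  rewrite inE => /subsetP/(_ _ QS) QC; exists Q => //.
  by split=> //; apply: bigcup_sup.
exists [set Q in circuits N | Q \subset A].
  by rewrite inE; apply/subsetP => Q; rewrite inE => /andP[].
apply/eqP; rewrite eqEsubset; apply/andP; split.
  apply/subsetP => x /exQ[Q QC [xQ sQA]]; apply/bigcupP; exists Q => //.
  by rewrite inE QC.
by apply/bigcupsP => Q; rewrite inE => /andP[].
Qed.

(** A basis that realizes the nullity of [S] and contains [Q :\ e], for a circuit [Q] in [S] through
    [e], omits [e]; with [e] outside [A] it omits fewer elements of [A] than of [S]. *)
Lemma nullity_proper N A S :
  S \in unions (circuits N) -> A \proper S -> nullity N A < nullity N S.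
Proof.
move=> /unionsP SU /properP[sAS [e eS eA]]; have [Q QC [eQ sQS]] := SU e eS.
have [B [BN sQB ->]] :=
  nullity_attained (circuitD1 QC eQ) (subset_trans (subsetDl _ _) sQS).
apply: leq_ltn_trans (nullity_leq A BN) _; apply: proper_card.
apply/properP; split; first exact: setSD.
exists e; rewrite !inE ?(negPf eA) ?andbF // eS andbT.
have := circuit_independent QC (basis_independent BN).
by apply: contra => eB; rewrite -(setD1K eQ) subUset sub1set eB.
Qed.

Lemma circuit_unions N Q : Q \in circuits N -> Q \in unions (circuits N).
Proof. by move=> QC; apply/unionsP => x xQ; exists Q. Qed.

Lemma unionsU N A B :
  A \in unions (circuits N) -> B \in unions (circuits N) ->
  A :|: B \in unions (circuits N).
Proof.
move=> /unionsP AU /unionsP BU; apply/unionsP => x /setUP[/AU|/BU] [Q QC [xQ sQ]].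
  by exists Q => //; split=> //; apply: subset_trans (subsetUl _ _).
by exists Q => //; split=> //; apply: subset_trans (subsetUr _ _).
Qed.

(** By [nullity_proper], nullity is injective on a chain of unions of circuits, and below [A] it
    takes values from 0 to [nullity N A]. *)
Lemma height_leq_nullity N A : height (unions (circuits N)) A <= nullity N A.
Proof.
apply/bigmax_leqP => K /andP[/forall_inP chainK /subsetP sKU].
have leK B : B \in K -> nullity N B < (nullity N A).+1.
  by move=> /sKU; rewrite inE ltnS => /andP[_ /nullityS].
have injK : {in K &, injective (fun B => inord (nullity N B) : 'I_(nullity N A).+1)}.
  move=> B1 B2 K1 K2 /(congr1 val); rewrite /= !inordK ?leK // => eqn.
  have /forall_inP/(_ B2 K2) := chainK B1 K1.
  have /andP[U1 _] : (B1 \in unions (circuits N)) && (B1 \subset A).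
    by have := sKU _ K1; rewrite inE.
  have /andP[U2 _] : (B2 \in unions (circuits N)) && (B2 \subset A).
    by have := sKU _ K2; rewrite inE.
  case/orP; rewrite subEproper => /predU1P[//|].
    by move/(nullity_proper U2); rewrite eqn ltnn.
  by move/(nullity_proper U1); rewrite eqn ltnn.
have := max_card [set (inord (nullity N B) : 'I_(nullity N A).+1) | B in K].
by rewrite card_in_imset // card_ord; case: #|K|.
Qed.

Lemma height_ltn (U : {set {set E}}) A B :
  A \in U -> B \in U -> A \proper B -> height U A < height U B.
Proof.
move=> AU BU ltAB.
pose chain S := [pred K : {set {set E}} |
  is_chain K && (K \subset [set B in U | B \subset S])].
have [K /andP[/forall_inP chainK /subsetP sK] ->] :
    exists2 K, chain A K & height U A = #|K|.-1.
  have /(eq_bigmax_cond (fun K : {set {set E}} => #|K|.-1))[K chainK heightE] :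
      0 < #|chain A|.
    apply/card_gt0P; exists set0; rewrite inE sub0set andbT.
    by apply/forall_inP => S; rewrite inE.
  by exists K.
(* Adding [A] first makes the chain non-empty: if [K] were empty, [B] alone would not raise the
   truncated predecessor of its size. *)
pose K' := A |: K.
have sK' S : S \in K' -> S \in U /\ S \subset A.
  by case/setU1P => [->|/sK]; [split | rewrite inE => /andP].
have chainK' : chain B (B |: K').
  apply/andP; split; last first.
    apply/subsetP => S /setU1P[->|/sK'[SU sSA]]; rewrite inE ?BU ?subxx // SU /=.
    exact: subset_trans (proper_sub ltAB).
  have sK'B S : S \in K' -> S \subset B.
    by case/sK' => _ /subset_trans; apply; apply: proper_sub.
  apply/forall_inP => S1 /setU1P[->|S1K']; apply/forall_inP => S2 /setU1P[->|S2K'].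
  - by rewrite subxx.
  - by rewrite sK'B ?orbT.
  - by rewrite sK'B.
  case/setU1P: S1K' (S1K') => [->|S1K] S1K'; first by rewrite orbC (sK' _ S2K').2.
  case/setU1P: S2K' => [->|S2K]; first by rewrite (sK' _ S1K').2.
  by have /forall_inP/(_ S2 S2K) := chainK S1 S1K.
have leK' : #|B |: K'|.-1 <= height U B.
  exact: (@leq_bigmax_cond _ (chain B) (fun K : {set {set E}} => #|K|.-1)).
apply: leq_trans leK'.
rewrite cardsU1; have -> /= : B \notin K'.
  by apply: contraL ltAB => /sK'[_ sBA]; rewrite properE sBA andbF.
have : 0 < #|K'| by apply/card_gt0P; exists A; rewrite setU11.
have : #|K| <= #|K'| by rewrite subset_leq_card // subsetUr.
by case: #|K|.
Qed.

Lemma set0_unions N : set0 \in unions (circuits N).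
Proof. by apply/unionsP => x; rewrite inE. Qed.

Lemma circuit_properU N Q1 Q2 :
  Q1 \in circuits N -> Q2 \in circuits N -> Q1 != Q2 -> Q1 \proper Q1 :|: Q2.
Proof.
move=> Q1C Q2C neqQ; rewrite properUl //.
by apply: contra neqQ => /(circuit_eq Q2C Q1C) ->.
Qed.

Lemma circuit_proper0 N Q : Q \in circuits N -> set0 \proper Q.
Proof. by move=> QC; rewrite proper0 (circuit_neq0 QC). Qed.

(** * Modular pairs of circuits *)

Lemma modular_pair_nullity N Q1 Q2 :
  Q1 \in circuits N -> Q2 \in circuits N -> Q1 != Q2 ->
  nullity N (Q1 :|: Q2) <= 2 -> modular_pair (circuits N) Q1 Q2.
Proof.
move=> Q1C Q2C neqQ nul2; rewrite /modular_pair Q1C Q2C neqQ /=.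
rewrite eqn_leq (leq_trans (height_leq_nullity _ _)) //=.
have U1 := circuit_unions Q1C; have U2 := circuit_unions Q2C.
have := height_ltn U1 (unionsU U1 U2) (circuit_properU Q1C Q2C neqQ).
have := height_ltn (set0_unions N) U1 (circuit_proper0 Q1C).
by move=> h1; apply: leq_trans; rewrite ltnS (leq_trans _ h1).
Qed.

(** Otherwise the empty set, [Q1], [Q1 :|: Q2] and the union of all three would be a strict chain,
    forcing nullity at least 3. *)
Lemma circuit_subU_nullity N Q1 Q2 Q3 :
  Q1 \in circuits N -> Q2 \in circuits N -> Q3 \in circuits N -> Q1 != Q2 ->
  nullity N (Q1 :|: Q2 :|: Q3) <= 2 -> Q3 \subset Q1 :|: Q2.
Proof.
move=> Q1C Q2C Q3C neqQ; apply: contraLR => nsub; rewrite -ltnNge.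
have U1 := circuit_unions Q1C; have U12 := unionsU U1 (circuit_unions Q2C).
have := nullity_proper U1 (circuit_proper0 Q1C).
have := nullity_proper U12 (circuit_properU Q1C Q2C neqQ).
have := nullity_proper (unionsU U12 (circuit_unions Q3C)) (properUl nsub).
move=> h3 h2 h1; apply: leq_ltn_trans h3; apply: leq_ltn_trans h2.
exact: leq_ltn_trans h1.
Qed.

(** If [Q] differed from [X], the strict chain from the empty set through [X] and [X :|: Q] to
    [X :|: Y] would have length 3; its last inclusion is strict because of [h]. *)
Lemma modular_pair_circuit N X Y Q h :
  modular_pair (circuits N) X Y -> Q \in circuits N -> Q \subset X :|: Y ->
  h \in Y :\: X -> h \notin Q -> Q = X.
Proof.
case/and4P => XC YC neqXY /eqP height2 QC sQ /setDP[hY hX] hQ.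
have UX := circuit_unions XC; have UXQ := unionsU UX (circuit_unions QC).
apply/eqP; rewrite eq_sym; apply: contraTT isT => neqXQ.
have h1 := height_ltn (set0_unions N) UX (circuit_proper0 XC).
have h2 := height_ltn UX UXQ (circuit_properU XC QC neqXQ).
have : X :|: Q \proper X :|: Y.
  apply/properP; split; first by rewrite subUset subsetUl.
  by exists h; rewrite !inE ?hY ?orbT // negb_or hX.
move/(height_ltn UXQ (unionsU UX (circuit_unions YC))).
by rewrite height2 ltnNge (leq_trans _ h2) // ltnS (leq_trans _ h1).
Qed.

Lemma modular_pair_sym C X Y : modular_pair C X Y = modular_pair C Y X.
Proof. by rewrite /modular_pair setUC eq_sym andbCA. Qed.

Lemma modular_pair_cocircuit N X Y f g h :
  modular_pair (circuits N) X Y ->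
  f \in X :\: Y -> h \in Y :\: X -> g \in X :&: Y ->
  exists V, [/\ V \in circuits (dual N), g \in V, f \in V, h \in V
    & V :&: (X :|: Y) \subset [set g; f; h]].
Proof.
move=> modXY fXY hYX /setIP[gX gY].
have /and4P[XC YC neqXY _] := modXY.
have /setDP[fX fY] := fXY; have /setDP[hY hX] := hYX.
have neqfh : f != h by apply: contraNneq hX => <-.
(* A circuit inside this set misses [h], so it is [X]; but it misses [f] as well. *)
have [B BN sB] : exists2 B, B \in bases N & (X :|: Y) :\: [set f; h] \subset B.
  apply/independentP; apply: contraT => /dependent_circuit[Q QC sQ].
  have fQ : f \notin Q by apply/negP => /(subsetP sQ); rewrite !inE eqxx.
  have hQ : h \notin Q by apply/negP => /(subsetP sQ); rewrite !inE eqxx orbT.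
  have := modular_pair_circuit modXY QC (subset_trans sQ (subsetDl _ _)) hYX hQ.
  by move=> QX; rewrite QX fX in fQ.
have fB : f \notin B.
  apply: contra (circuit_independent XC (basis_independent BN)) => fB.
  apply/subsetP => x xX; have [->//|neqxf] := eqVneq x f.
  apply: (subsetP sB); rewrite !inE xX (negPf neqxf) /= andbT.
  by apply: contraNneq hX => <-.
have hB : h \notin B.
  apply: contra (circuit_independent YC (basis_independent BN)) => hB.
  apply/subsetP => x xY; have [->//|neqxh] := eqVneq x h.
  apply: (subsetP sB); rewrite !inE xY (negPf neqxh) orbT orbF andbT.
  by apply: contraNneq fY => <-.
have gB : g \in B.
  apply: (subsetP sB); rewrite !inE gX negb_or andbT.
  by rewrite (contraNneq _ fY) ?(contraNneq _ hX) // => <-.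
(* The fundamental cocircuit of [g] for [B] meets the union only in [g], [f], [h]; it contains [f]
   and [h] because it cannot meet [X] or [Y] in [g] alone. *)
have [||V [VC sV gV]] := @fundamental_circuit (dual N) (~: B) g.
- by rewrite in_dual_bases setCK.
- by rewrite inE gB.
have sVW : V :&: (X :|: Y) \subset [set g; f; h].
  apply/subsetP => x /setIP[/(subsetP sV) + xW]; rewrite !inE -orbA.
  case: eqP => //= _; apply: contraR => nfh.
  by apply: (subsetP sB); rewrite !inE nfh -in_setU.
exists V; split=> //.
  apply: contraR (circuit_cocircuit_neq1 g XC VC) => fV.
  apply/eqP/setP => x; rewrite in_set1; apply/setIP/eqP => [[xX xV]|->//].
  have /subsetP/(_ x) := sVW; rewrite !inE xV xX => /(_ isT).
  case/orP => [/orP[/eqP//|/eqP xf]|/eqP xh]; first by rewrite -xf xV in fV.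
  by rewrite -xh xX in hX.
apply: contraR (circuit_cocircuit_neq1 g YC VC) => hV.
apply/eqP/setP => x; rewrite in_set1; apply/setIP/eqP => [[xY xV]|->//].
have /subsetP/(_ x) := sVW; rewrite !inE xV xY orbT => /(_ isT).
case/orP => [/orP[/eqP//|/eqP xf]|/eqP xh]; first by rewrite -xf xY in fY.
by rewrite -xh xV in hV.
Qed.

End MatroidTheory.

(** * Arithmetic in a skew tract *)

Section TractTheory.
Local Open Scope mset_scope.
Local Open Scope group_scope.
Local Open Scope tract_scope.
HB.instance Definition _ (K : choiceType) :=
  Monoid.isComLaw.Build {mset K} mset0 (@msetD K)
    (@msetDA K) (@msetDC K) (@mset0D K).

Variable T : skewTract.
Implicit Types (a x y z : T) (g h : tgroup T) (A B : {mset (tgroup T)}).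

Lemma enum_msetD A B : perm_eq (enum_mset (A `+` B)) (enum_mset A ++ enum_mset B).
Proof.
by apply/allP => x _ /=; rewrite count_cat !count_mem_mset msetE2.
Qed.

Lemma lactD g A B : lact g (A `+` B) = lact g A `+` lact g B.
Proof.
apply/msetP => x; rewrite msetE2 !mset_seqE -count_cat -map_cat.
exact/permP/perm_map/enum_msetD.
Qed.

Lemma ractD A B g : ract (A `+` B) g = ract A g `+` ract B g.
Proof.
apply/msetP => x; rewrite msetE2 !mset_seqE -count_cat -map_cat.
exact/permP/perm_map/enum_msetD.
Qed.

Lemma lact_to_semiring g x : lact g (to_semiring x) = to_semiring ((Some g : T) * x).
Proof.
apply/msetP => y; rewrite mset_seqE; case: x => [h|] /=.
  by rewrite enum_msetn /= msetnE addn0 eq_sym.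
by rewrite enum_mset0 mset0E.
Qed.

Lemma ract_to_semiring x g : ract (to_semiring x) g = to_semiring (x * (Some g : T)).
Proof.
apply/msetP => y; rewrite mset_seqE; case: x => [h|] /=.
  by rewrite enum_msetn /= msetnE addn0 eq_sym.
by rewrite enum_mset0 mset0E.
Qed.

Lemma null_lmul a x y z : a != 0 ->
  null (to_semiring x `+` to_semiring y `+` to_semiring z) ->
  null (to_semiring (a * x) `+` to_semiring (a * y) `+` to_semiring (a * z)).
Proof.
by case: a => // g _ /(null_lact g); rewrite !lactD !lact_to_semiring.
Qed.

Lemma null_rmul a x y z : a != 0 ->
  null (to_semiring x `+` to_semiring y `+` to_semiring z) ->
  null (to_semiring (x * a) `+` to_semiring (y * a) `+` to_semiring (z * a)).
Proof.
by case: a => // g _ /(null_ract g); rewrite !ractD !ract_to_semiring.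
Qed.

(** Conjugating the null element 1 + eps by [g] gives 1 + g eps g^-1, and eps is unique. *)
Lemma tepsC g : teps T * g = g * teps T.
Proof.
apply: (mulIg g^-1); rewrite mulgK; apply/esym/null_eps_unique.
have := null_ract g^-1 (null_lact g (null_eps T)).
rewrite -[[mset teps T]]/(to_semiring (Some (teps T) : T)).
rewrite -[[mset 1]]/(to_semiring (Some 1 : T)).
by rewrite lactD !lact_to_semiring ractD !ract_to_semiring /= mulg1 mulgV.
Qed.

(** Multiplying 1 + eps by eps^-1 gives eps^-1 + 1, so eps^-1 = eps by uniqueness. *)
Lemma teps2 : teps T * teps T = 1.
Proof.
suff eV : (teps T)^-1 = teps T by rewrite -[X in _ * X]eV mulgV.
apply: null_eps_unique; have := null_lact (teps T)^-1 (null_eps T).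
rewrite -[[mset teps T]]/(to_semiring (Some (teps T) : T)).
rewrite -[[mset 1]]/(to_semiring (Some 1 : T)).
by rewrite lactD !lact_to_semiring /= mulg1 mulVg msetDC.
Qed.

Lemma toppK : involutive (@topp T).
Proof. by case=> [g|] //; congr Some; rewrite /= mulgA teps2 mul1g. Qed.

Lemma mulNt x y : - x * y = - (x * y).
Proof. by rewrite /topp mulgA. Qed.

Lemma multN x y : x * - y = - (x * y).
Proof.
by case: x y => [g|] [h|] //; congr Some; rewrite /= !mulgA tepsC.
Qed.

Lemma topp_eq0 x : (- x == 0) = (x == 0).
Proof. by case: x. Qed.

Lemma tmul_neq0 x y : (x * y != 0) = (x != 0) && (y != 0).
Proof. by case: x y => [g|] [h|]. Qed.

Lemma tmulV x : x != 0 -> x * x^-1 = 1.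
Proof. by case: x => [g|] // _; congr Some; apply: mulgV. Qed.

Lemma tmulVt x : x != 0 -> x^-1 * x = 1.
Proof. by case: x => [g|] // _; congr Some; apply: mulVg. Qed.

Lemma tinv_neq0 x : (x^-1 != 0) = (x != 0).
Proof. by case: x. Qed.

(** Scaling reduces two nonzero terms to the uniqueness of eps, and a single nonzero term to 1,
    which is not null. *)
Lemma to_semiring_null2 x y :
  null (to_semiring x `+` to_semiring y) <-> x = - y.
Proof.
have null1g g : ~ null [mset g].
  move/(null_lact g^-1); have := lact_to_semiring g^-1 (Some g : T).
  by rewrite /= mulVg => ->; apply: null1.
case: x y => [g|] [h|] /=.
- split=> [|[->]].
    move/(null_lact h^-1); have /= := lactD h^-1 [mset g] [mset h] => ->.
    have /= -> := lact_to_semiring h^-1 (Some g : T).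
    have /= -> := lact_to_semiring h^-1 (Some h : T).
    rewrite mulVg msetDC => /null_eps_unique eps; congr Some.
    by rewrite tepsC -eps mulVKg.
  have := null_ract h (null_eps T).
  have /= -> := ractD [mset 1] [mset (teps T)] h.
  have /= -> := ract_to_semiring (Some 1 : T) h.
  have /= -> := ract_to_semiring (Some (teps T) : T) h.
  by rewrite mul1g msetDC.
- by rewrite msetD0; split=> // /null1g.
- by rewrite mset0D; split=> // /null1g.
- by rewrite mset0D; split=> // _; apply: null0.
Qed.

Variable i : involution T.

Lemma bar_mul x y : i (x * y) = i x * i y.
Proof. exact: (bar_monoid i).2. Qed.

Lemma bar_neq0 x : (i x != 0) = (x != 0).
Proof. by rewrite -{2}[x](barK i) -{2}(bar0 i) (inj_eq (inv_inj (barK i))). Qed.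

Lemma tmulIr a x y : a != 0 -> x * a = y * a -> x = y.
Proof.
move=> a0 /(congr1 (fun z => z * a^-1)); rewrite -!mulgA tmulV //.
by rewrite !mulg1.
Qed.

Lemma tmulIl a x y : a != 0 -> a * x = a * y -> x = y.
Proof.
move=> a0 /(congr1 (fun z => a^-1 * z)); rewrite !mulgA tmulVt //.
by rewrite !mul1g.
Qed.

(** Of the three signs, the outer one comes from the condition on T-cocircuits, the next from the
    dual coordinates and the inner one from the coordinate of a circuit. Applying the involution and
    clearing denominators gives two-term orthogonality. *)
Lemma cross_ratio_dual xa xb ya yb : xa != 0 -> xb != 0 -> ya != 0 ->
  yb * ya^-1 = - - i (- (xb^-1 * xa)) <-> xa * i ya = - (xb * i yb).
Proof.
move=> xa0 xb0 ya0; rewrite toppK.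
have iya0 : i ya != 0 by rewrite bar_neq0.
transitivity (i yb = - (xb^-1 * xa) * i ya).
  split=> [yE|iyb]; last first.
    apply: (@tmulIr ya) => //; rewrite -mulgA tmulVt // mulg1.
    by rewrite -[ya in RHS](barK i) -bar_mul -iyb barK.
  by rewrite -[_ * i ya](barK i) bar_mul -yE barK -mulgA tmulVt // mulg1.
split=> [->|xE].
  by rewrite mulNt multN toppK !mulgA tmulV // mul1g.
apply: (tmulIl xb0); rewrite mulNt multN !mulgA tmulV // mul1g.
by rewrite xE toppK.
Qed.

End TractTheory.

(** * Orthogonality of T-vectors *)

Section Vectors.
Local Open Scope mset_scope.
Local Open Scope group_scope.
Local Open Scope tract_scope.
Variables (T : skewTract) (i : involution T) (E : finType).
Implicit Types (N : matroid E) (F S : {set E}) (X Y Z V : {ffun E -> T}).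
Implicit Types (C D : set {ffun E -> T}) (e f g h : E).

Lemma in_supp X e : (e \in supp X) = (X e != 0).
Proof. by rewrite inE. Qed.

Lemma supp_lscale (t : T) X : t != 0 -> supp (lscale t X) = supp X.
Proof. by move=> t0; apply/setP => e; rewrite !in_supp ffunE tmul_neq0 t0. Qed.

Lemma supportsP C S : reflect (exists2 X, C X & supp X = S) (S \in supports C).
Proof. by rewrite inE; apply: asboolP. Qed.

Lemma dotprod_setI X Y S : supp X :&: supp Y \subset S ->
  dotprod i X Y = \big[msetD/mset0]_(e in S) to_semiring (X e * i (Y e)).
Proof.
move=> sS; rewrite [RHS]big_mkcond; apply: eq_bigr => e _.
case: ifPn => // /(contra (subsetP sS e)); rewrite in_setI !in_supp.
by rewrite -(bar_neq0 i (Y e)) -tmul_neq0 negbK => /eqP ->.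
Qed.

Lemma orthogonal_set2 X Y e f : e != f -> supp X :&: supp Y \subset [set e; f] ->
  orthogonal i X Y <-> X e * i (Y e) = - (X f * i (Y f)).
Proof.
move=> ef /dotprod_setI; rewrite /orthogonal => ->.
rewrite big_setU1 ?inE //= big_set1; exact: to_semiring_null2.
Qed.

Lemma orthogonal_set3 X Y e f g : e != f -> e != g -> f != g ->
  supp X :&: supp Y \subset [set e; f; g] ->
  orthogonal i X Y <-> null (to_semiring (X e * i (Y e)) `+`
    to_semiring (X f * i (Y f)) `+` to_semiring (X g * i (Y g))).
Proof.
move=> ef eg fg /dotprod_setI; rewrite /orthogonal => ->.
rewrite -setUA !big_setU1 ?inE ?negb_or ?ef //= big_set1 msetDA.
by split.
Qed.

(** * Quasi-Plücker coordinates and T-cocircuits *)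

Lemma in_adjacent_bases N F e f :
  reflect [/\ e != f, e \notin F, f \notin F, e |: F \in bases N & f |: F \in bases N]
          ((e |: F, f |: F) \in adjacent_bases N).
Proof.
rewrite inE /=; apply: (iffP and3P) => [[eN fN /cards1P[x ex]]|[ef eF fF eN fN]].
  have /setDP[] : x \in (e |: F) :\: (f |: F) by rewrite ex set11.
  rewrite !inE => /orP[/eqP ->|->]; last by rewrite orbT.
  rewrite negb_or => /andP[ef eF]; split=> //.
  apply/negP => fF; have fFE : f |: F = F by apply/setUidPr; rewrite sub1set.
  have /(basis_sub_eq fN eN)/setP/(_ e) : f |: F \subset e |: F.
    by rewrite fFE subsetUr.
  by rewrite fFE setU11 (negPf eF).
split=> //; apply/cards1P; exists e; apply/setP => x; rewrite !inE.
have [->|_] /= := eqVneq x e; first by rewrite (negPf ef) (negPf eF).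
by rewrite negb_or -andbA andNb andbF.
Qed.

(** Whatever witness [xget] picks, its two elements must be [f] and [e], its support is the same
    fundamental circuit, and the left scalar given by (C3) cancels in the ratio. *)
Lemma quasi_plucker_circuit N C X F e f :
  left_signature N C -> C X -> e |: F \in bases N -> e != f ->
  e \notin F -> f \notin F -> e \in supp X -> f \in supp X ->
  supp X \subset e |: (f |: F) ->
  quasi_plucker C (f |: F) (e |: F) = - ((X f)^-1 * X e).
Proof.
move=> [_ _ C3 CN] CX eFN ef eF fF eX fX sX; rewrite /quasi_plucker.
case: xgetP => [t _ [F' [f' [e' [X' [fE eE CX' /and3P[f'X' e'X' sX'] ->]]]]]|];
    last first.
  move/(_ (- ((X f)^-1 * X e)))=> [].
  by exists F, f, e, X; split=> //; rewrite fX eX setUCA.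
have f'E : f' = f.
  have /setP/(_ f) := eE; have /setP/(_ f) := fE; rewrite !inE eqxx (negPf fF).
  rewrite [f == e]eq_sym (negPf ef) /=.
  by move=> /esym/orP[/eqP-> //|->]; rewrite orbT.
have e'E : e' = e.
  have /setP/(_ e) := fE; have /setP/(_ e) := eE.
  rewrite !inE eqxx (negPf eF) (negPf ef) /=.
  by move=> /esym/orP[/eqP-> //|->]; rewrite orbT.
rewrite {}f'E {}e'E in fE eE f'X' e'X' sX' *.
have X'E : supp X' = supp X.
  apply: (fundamental_circuit_unique (x := f) eFN).
  - by rewrite -CN; apply/supportsP; exists X'.
  - by rewrite -CN; apply/supportsP; exists X.
  - by rewrite eE.
  - by rewrite setUCA.
have sXX' : supp X \subset supp X' by rewrite X'E.
have [u u0 ->] := C3 _ _ CX CX' sXX'; rewrite !ffunE; congr (- _).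
by rewrite invgM -mulgA [u^-1 * _]mulgA tmulVt // mul1g.
Qed.

(** With F' the complement of [e |: (f |: F)], the complements of [e |: F] and [f |: F] are
    [f |: F'] and [e |: F']. As [X] avoids [F], it computes the coordinate of this pair, and
    [cross_ratio_dual] applies. *)
Lemma dual_quasi_plucker_orthogonal N C X Y F e f :
  left_signature N C -> C X -> (e |: F, f |: F) \in adjacent_bases (dual N) ->
  e \in supp X -> f \in supp X -> [disjoint supp X & F] -> Y e != 0 ->
  Y f * (Y e)^-1 = - dual_quasi_plucker i C (e |: F) (f |: F) <->
  X e * i (Y e) = - (X f * i (Y f)).
Proof.
move=> sigC CX /in_adjacent_bases[ef eF fF].
rewrite !in_dual_bases => eFN fFN eX fX dXF Ye.
have coF x y : x != y -> x \notin F -> ~: (y |: F) = x |: ~: (x |: (y |: F)).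
  move=> xy xF; apply/setP => z; rewrite !inE !negb_or.
  by have [->|] := eqVneq z x; rewrite ?xy ?xF.
rewrite /dual_quasi_plucker (coF f e) // 1?eq_sym // (coF e f) // setUCA.
rewrite (quasi_plucker_circuit sigC CX _ ef _ _ eX fX) ?inE ?eqxx ?orbT //.
- by apply: cross_ratio_dual => //; rewrite -in_supp.
- by rewrite -(coF e f).
- apply/subsetP => x xX; rewrite !inE; have xF := disjointFr dXF xX.
  by case: eqP => //= _; case: eqP => //= _; rewrite xF.
Qed.

(** The adjacent dual bases are the complements of [B] and of [(e |: B) :\ f], for a basis [B]
    containing [supp X :\ e] and meeting [supp Y] only in [f]. *)
Lemma tcocircuit_orthogonal2 (M : weakLeftMatroid T E) N X Y e f :
  left_signature N (tcircuits M) -> tcircuits M X -> tcocircuits i M N Y ->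
  e != f -> supp X :&: supp Y = [set e; f] -> orthogonal i X Y.
Proof.
move=> sigC CX [YC Yqp] ef XY; have [_ _ _ CN] := sigC.
have /setIP[eX eY] : e \in supp X :&: supp Y by rewrite XY set21.
have /setIP[fX fY] : f \in supp X :&: supp Y by rewrite XY set22.
have XC : supp X \in circuits N by rewrite -CN; apply/supportsP; exists X.
have [|B [BN sXB BYf]] := cocircuit_basis (circuitD1 XC eX) YC fY.
  by rewrite setIDAC XY setU1K ?inE.
have /setIP[fB _] : f \in B :&: supp Y by rewrite BYf set11.
have eB : e \notin B.
  have := circuit_independent XC (basis_independent BN).
  by apply: contra => eB; rewrite -(setD1K eX) subUset sub1set eB.
pose F := ~: B :\ e.
have eF : e |: F = ~: B by rewrite setD1K // inE.
have adj : (e |: F, f |: F) \in adjacent_bases (dual N).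
  apply/in_adjacent_bases; rewrite eF !in_dual_bases setCK !inE eqxx fB andbF.
  split=> //; have -> : ~: (f |: F) = (e |: B) :\ f.
    by apply/setP => x; rewrite !inE negb_or negb_and !negbK.
  by apply: (circuit_exchange BN eB XC) fX; rewrite -subDset.
have dXF : [disjoint supp X & F].
  by rewrite disjoints_subset setCD setCK setUC -subDset.
have Ye : Y e != 0 by rewrite -in_supp.
apply/(orthogonal_set2 ef); first by rewrite XY.
apply/(dual_quasi_plucker_orthogonal sigC CX adj) => //; apply: Yqp => //.
rewrite setUCA eF; apply/subsetP => x xY; rewrite !inE -implyNb; apply/implyP.
by apply: contra => xB; rewrite -in_set1 -BYf inE xB.
Qed.

(** The fundamental circuit of [e] for the basis [~: (e |: F)] meets [supp Y] in exactly [e] and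
    [f], so orthogonality to it is the required ratio. *)
Lemma right_signature_sub_tcocircuits (M : weakLeftMatroid T E) N D :
  left_signature N (tcircuits M) -> right_signature (dual N) D ->
  orthogonal_upto i 2 (tcircuits M) D -> (D `<=` tcocircuits i M N)%classic.
Proof.
move=> sigC [_ _ _ DN] orth2 Y DY; have [_ _ _ CN] := sigC.
have YC : supp Y \in circuits (dual N) by rewrite -DN; apply/supportsP; exists Y.
split=> // F e f adj eY fY sY.
have [ef eF fF eFN _] := in_adjacent_bases _ _ _ _ adj.
rewrite in_dual_bases in eFN.
have [|Q [+ sQ eQ]] := fundamental_circuit eFN (x := e); first by rewrite !inE eqxx.
rewrite -CN => /supportsP[X CX QX]; rewrite -{Q}QX in sQ eQ.
have sXY : supp X :&: supp Y \subset [set e; f].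
  apply/subsetP => x /setIP[/(subsetP sQ) + /(subsetP sY)]; rewrite !inE.
  by case: eqP => //= _; case: eqP => //= _ /negPf ->.
have fX : f \in supp X.
  have XC : supp X \in circuits N by rewrite -CN; apply/supportsP; exists X.
  apply: contraR (circuit_cocircuit_neq1 e XC YC) => fX.
  apply/eqP/setP => x; rewrite in_set1; apply/idP/eqP => [xXY|->].
    have := subsetP sXY x xXY; rewrite !inE => /orP[/eqP //|/eqP xf].
    by move: xXY fX; rewrite xf inE => /andP[->].
  by rewrite inE eQ.
apply/(dual_quasi_plucker_orthogonal sigC CX adj) => //.
- rewrite disjoints_subset; apply: subset_trans sQ _.
  by rewrite setCU subUset sub1set !inE eF subsetIr.
- by rewrite -in_supp.
- apply/orthogonal_set2 => //; apply: orth2 => //.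
  by apply: leq_trans (subset_leq_card sXY) _; rewrite cards2 ef.
Qed.

(** Any two elements of a cocircuit are exchanged by some pair of adjacent dual bases, so [V] and
    the member [Y] of [D] on the same support have equal ratios, and [V] is a right multiple of
    [Y]. *)
Lemma tcocircuits_sub (M : weakLeftMatroid T E) N D :
  right_signature (dual N) D -> (D `<=` tcocircuits i M N)%classic ->
  (tcocircuits i M N `<=` D)%classic.
Proof.
move=> [_ D2 _ DN] sD V [VC Vqp].
have := VC; rewrite -DN => /supportsP[Y DY YV].
have [_ Yqp] := sD _ DY.
have /set0Pn[e eV] := circuit_neq0 VC.
have Ye : Y e != 0 by rewrite -in_supp YV.
have Ve : V e != 0 by rewrite -in_supp.
suff -> : V = rscale Y ((Y e)^-1 * V e).
  by apply: D2 => //; rewrite tmul_neq0 tinv_neq0 Ye.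
apply/ffunP => f; rewrite ffunE mulgA.
have [->|fe] := eqVneq f e; first by rewrite tmulV // mul1g.
have [fV|] := boolP (f \in supp V); last first.
  rewrite in_supp negbK => /eqP Vf; have : f \notin supp Y by rewrite YV in_supp Vf eqxx.
  by rewrite in_supp negbK => /eqP ->; rewrite Vf.
have /independentP[B BN sB] := circuitD1 VC fV.
have fB : f \notin B.
  have := circuit_independent VC (basis_independent BN).
  by apply: contra => fB; rewrite -(setD1K fV) subUset sub1set fB.
have eB : e \in B by apply: (subsetP sB); rewrite !inE eq_sym fe -in_supp.
have sVB : supp V \subset f |: B by rewrite -subDset.
have BE : e |: (B :\ e) = B by rewrite setD1K.
have adj : (e |: (B :\ e), f |: (B :\ e)) \in adjacent_bases (dual N).
  apply/in_adjacent_bases; rewrite BE !inE eqxx (negPf fB) andbF eq_sym; split=> //.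
  have -> : f |: (B :\ e) = (f |: B) :\ e.
    by apply/setP => x; rewrite !inE; case: eqP => //= ->; rewrite fe.
  exact: circuit_exchange fB VC sVB eV.
have sV : supp V \subset e |: (f |: (B :\ e)) by rewrite setUCA BE.
rewrite (Yqp (B :\ e) e f) ?YV // -(Vqp (B :\ e) e f) //.
by rewrite -mulgA tmulVt // mulg1.
Qed.

(** * From (C4) to orthogonality at three elements, and back *)

Lemma axiomC4_orthogonal3 N C X Y e f g :
  left_signature N C -> axiomC4 C -> supp Y \in circuits (dual N) ->
  (forall Z a b, C Z -> a != b -> supp Z :&: supp Y = [set a; b] ->
    orthogonal i Z Y) ->
  C X -> e != f -> e != g -> f != g -> supp X :&: supp Y = [set e; f; g] ->
  orthogonal i X Y.
Proof.
move=> [_ C2 C3 CN] C4 YC orth2 CX ef eg fg XY.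
have circ Z : C Z -> supp Z \in circuits N.
  by move=> CZ; rewrite -CN; apply/supportsP; exists Z.
have /setIP[eX eY] : e \in supp X :&: supp Y by rewrite XY !inE eqxx.
have /setIP[fX fY] : f \in supp X :&: supp Y by rewrite XY !inE eqxx orbT.
have /setIP[gX gY] : g \in supp X :&: supp Y by rewrite XY !inE eqxx orbT.
have [||B [BN sXB BYe]] :=
    @cocircuit_basis _ N (supp X :\: [set f; g]) (supp Y) e _ YC eY.
- apply: independentS (circuitD1 (circ _ CX) fX).
  by apply: setDS; rewrite sub1set set21.
- rewrite setIDAC XY; apply/subsetP => x; rewrite !inE negb_or.
  by do 2![case: eqP => //= _]; rewrite !orbF.
have eB : e \in B by have := set11 e; rewrite -BYe => /setIP[].
have notB x : x != e -> x \in supp Y -> x \notin B.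
  by move=> xe xY; apply: contra xe => xB; rewrite -in_set1 -BYe inE xB.
have fB : f \notin B by rewrite notB // eq_sym.
have gB : g \notin B by rewrite notB // eq_sym.
(* Since [B] meets [supp Y] only in [e], such a circuit meets [supp Y] inside {e, x}, and it cannot
   meet it in [x] alone. *)
have fundamental x : x != e -> x \in supp Y -> x \notin B ->
    exists2 W, C W & [/\ supp W \subset x |: B, x \in supp W
      & supp W :&: supp Y = [set e; x]].
  move=> xe xY xB; have [Q [QC sQ xQ]] := fundamental_circuit BN xB.
  have := QC; rewrite -CN => /supportsP[W CW WQ]; exists W; rewrite ?WQ //.
  have sQY : Q :&: supp Y \subset [set e; x].
    apply/subsetP => y /setIP[/(subsetP sQ) + yY]; rewrite in_setU1 in_set2.
    case/orP => [->|yB]; first by rewrite orbT.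
    by rewrite -in_set1 -BYe in_setI yB yY.
  split=> //; apply/eqP; rewrite eqEsubset sQY; apply/subsetP => y.
  rewrite !inE => /orP[|] /eqP -> ; last by rewrite xQ -in_supp.
  apply: contraR (circuit_cocircuit_neq1 x QC YC) => eQY.
  apply/eqP/setP => z; rewrite in_set1; apply/idP/eqP => [zQY|->].
    have := subsetP sQY z zQY; rewrite !inE => /orP[/eqP ze|/eqP //].
    by move: zQY eQY; rewrite ze inE in_supp => ->.
  by rewrite inE xQ.
have [|U CU [sU fU UY]] := fundamental f _ fY fB; first by rewrite eq_sym.
have [|W CW [sW gW WY]] := fundamental g _ gY gB; first by rewrite eq_sym.
have sXW : supp X \subset f |: (g |: B) by rewrite setUA -subDset.
have sUW : supp U \subset f |: (g |: B).
  by apply: subset_trans sU _; rewrite setUS // subsetUr.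
have sWW : supp W \subset f |: (g |: B) by apply: subset_trans sW (subsetUr _ _).
have null2 S : S \subset f |: (g |: B) -> nullity N S <= 2.
  move=> sS; apply: leq_trans (nullity_leq S BN) _.
  rewrite (leq_trans (subset_leq_card (_ : _ \subset [set f; g]))) ?cards2 ?fg //.
  by rewrite subDset setUC -setUA.
have gU : g \notin supp U.
  by apply: contra gB => /(subsetP sU); rewrite !inE eq_sym (negPf fg).
have fW : f \notin supp W.
  by apply: contra fB => /(subsetP sW); rewrite !inE (negPf fg).
have /subsetPn[p pU pX] : ~~ (supp U \subset supp X).
  by apply: contra gU => /(circuit_eq (circ _ CU) (circ _ CX)) ->.
have pW : p \in supp W.
  have /subsetP/(_ p pU)/setUP[pX'|//] : supp U \subset supp X :|: supp W.
    apply: (circuit_subU_nullity (circ _ CX) (circ _ CW) (circ _ CU)).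
      by apply: contraNneq fW => <-.
    by apply: null2; rewrite !subUset sXW sWW.
  by rewrite pX' in pX.
rewrite in_supp in pU; rewrite in_supp in pW.
(* [W] is scaled so that [p] can be eliminated between it and [U]. *)
pose W' := lscale (- U p * (W p)^-1) W.
have t0 : - U p * (W p)^-1 != 0 by rewrite tmul_neq0 topp_eq0 tinv_neq0 pU.
have W'W : supp W' = supp W by rewrite supp_lscale.
have CW' : C W' by apply: C2.
have W'p : U p = - W' p by rewrite ffunE -mulgA tmulVt // mulg1 toppK.
have modUW : tmodular_pair C U W'.
  split=> //; rewrite CN W'W; apply: (modular_pair_nullity (circ _ CU) (circ _ CW)).
    by apply: contraNneq gU => ->.
  by apply: null2; rewrite subUset sUW sWW.
have [Z [CZ Zp nullZ]] := C4 _ _ _ modUW W'p pU.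
have sZ : supp Z \subset supp U :|: supp W.
  apply/subsetP => x xZ; rewrite inE; apply: contraLR xZ; rewrite negb_or.
  rewrite -W'W !in_supp !negbK => /andP[/eqP Ux /eqP W'x].
  have := nullZ x; rewrite Ux W'x -topp_eq0 msetD0.
  by move/to_semiring_null2 => /esym/eqP; rewrite topp_eq0.
(* Both avoid [p]; if they differed, nullity 2 would force [supp U], which contains [p], into their
   union. *)
have ZX : supp Z = supp X.
  apply/eqP; apply: contraTT isT => neqZX.
  have /subsetP/(_ p) : supp U \subset supp Z :|: supp X.
    apply: (circuit_subU_nullity (circ _ CZ) (circ _ CX) (circ _ CU)) => //.
    apply: null2; rewrite !subUset sXW sUW !andbT.
    by apply: subset_trans sZ _; rewrite subUset sUW.
  by rewrite in_setU (negPf pX) !in_supp Zp eqxx pU => /(_ isT).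
have sZX : supp Z \subset supp X by rewrite ZX.
have [t u0 ->] := C3 _ _ CZ CX sZX.
have orthUY : orthogonal i U Y by apply: (orth2 _ e f CU).
have orthWY : orthogonal i W' Y by apply: (orth2 _ e g CW'); rewrite ?W'W.
have sZY : supp Z :&: supp Y \subset [set e; f; g] by rewrite ZX XY.
have nullE := nullZ e.
have Zf : Z f = U f.
  have := nullZ f; have -> : W' f = 0.
    by move: fW; rewrite -W'W in_supp negbK => /eqP.
  by rewrite msetD0 => /to_semiring_null2; rewrite toppK.
have Zg : Z g = W' g.
  have := nullZ g; have -> : U g = 0.
    by move: gU; rewrite in_supp negbK => /eqP.
  by rewrite mset0D => /to_semiring_null2; rewrite toppK.
have Ye : i (Y e) != 0 by rewrite bar_neq0 -in_supp.
(* The relation (C4) at [e] is multiplied by [i (Y e)] on the right and eps on the left;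
   orthogonality of [U] and [W'] with [Y] then turns their terms at [e] into the terms of [Z] at [f]
   and [g]. *)
have nullZY : null (to_semiring (Z e * i (Y e)) `+` to_semiring (Z f * i (Y f))
    `+` to_semiring (Z g * i (Y g))).
  have /(orthogonal_set2 ef)[/(_ orthUY) UYe _] :
      supp U :&: supp Y \subset [set e; f] by rewrite UY.
  have /(orthogonal_set2 eg)[/(_ orthWY) WYe _] :
      supp W' :&: supp Y \subset [set e; g].
    by rewrite W'W WY.
  have eps0 : (Some (teps T) : T) != 0 by [].
  have := null_lmul eps0 (null_rmul Ye nullE).
  rewrite -!/(topp _) UYe WYe mulNt !toppK Zf Zg.
  by rewrite msetDC msetDA.
apply/(orthogonal_set3 ef eg fg); first by rewrite supp_lscale.
by rewrite !ffunE -!mulgA; apply: null_lmul.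
Qed.

Lemma orthogonal3_axiomC4 N C D :
  left_signature N C -> right_signature (dual N) D -> orthogonal_upto i 3 C D ->
  axiomC4 C.
Proof.
move=> [_ C2 _ CN] [_ _ _ DN] orth3 X Y e [CX CY].
rewrite CN => modXY XYe Xe.
have /and4P[XC YC neqXY _] := modXY.
have modYX : modular_pair (circuits N) (supp Y) (supp X) by rewrite modular_pair_sym.
have eX : e \in supp X by rewrite in_supp.
have eY : e \in supp Y by rewrite in_supp -topp_eq0 -XYe.
have eXY : e \in supp X :&: supp Y by rewrite inE eX.
have /subsetPn[f0 f0X f0Y] : ~~ (supp X \subset supp Y).
  by apply: contra neqXY => /(circuit_eq XC YC) ->.
have /subsetPn[h0 h0Y h0X] : ~~ (supp Y \subset supp X).
  by apply: contra neqXY => /(circuit_eq YC XC) ->.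
have f0XY : f0 \in supp X :\: supp Y by rewrite inE f0Y.
have h0YX : h0 \in supp Y :\: supp X by rewrite inE h0X.
have [Z0 Z0C /subsetD1P[sZ0 eZ0]] := circuit_elimination XC YC neqXY eX.
(* If [Z0] missed [f], it would be [supp Y], which contains [e]. *)
have fZ0 f : f \in supp X :\: supp Y -> f \in Z0.
  move=> fXY; apply: contraR eZ0 => fZ0.
  by rewrite (modular_pair_circuit modYX Z0C _ fXY fZ0) // setUC.
have hZ0 h : h \in supp Y :\: supp X -> h \in Z0.
  move=> hYX; apply: contraR eZ0 => hZ0.
  by rewrite (modular_pair_circuit modXY Z0C _ hYX hZ0).
have := Z0C; rewrite -CN => /supportsP[Z1 CZ1 Z1E].
have Z1f0 : Z1 f0 != 0 by rewrite -in_supp Z1E fZ0.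
have t0 : X f0 * (Z1 f0)^-1 != 0 by rewrite tmul_neq0 tinv_neq0 Z1f0 -in_supp f0X.
pose Z := lscale (X f0 * (Z1 f0)^-1) Z1.
have CZ : C Z by apply: C2.
have ZE : supp Z = Z0 by rewrite supp_lscale.
have Zf0 : Z f0 = X f0 by rewrite ffunE -mulgA tmulVt // mulg1.
have Ze : Z e = 0 by apply/eqP; move: eZ0; rewrite -ZE in_supp negbK.
(* Here [v] is the conjugate of a vector of [D] on the cocircuit through [f], [g], [h]; the
   relations are its orthogonality to [X], [Y] and [Z]. *)
have cocircuit f g h : f \in supp X :\: supp Y -> h \in supp Y :\: supp X ->
    g \in supp X :&: supp Y -> exists v : E -> T,
    [/\ [/\ v f != 0, v g != 0 & v h != 0],
      X g * v g = - (X f * v f), Y g * v g = - (Y h * v h)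
    & null (to_semiring (Z g * v g) `+` to_semiring (Z f * v f)
        `+` to_semiring (Z h * v h))].
  move=> fXY hYX gXY.
  have [V [VC gV fV hV sV]] := modular_pair_cocircuit modXY fXY hYX gXY.
  have [/setDP[fX fY] /setDP[hY hX]] := (fXY, hYX).
  have /setIP[gX gY] := gXY.
  have gf : g != f by apply: contraNneq fY => <-.
  have gh : g != h by apply: contraNneq hX => <-.
  have fh : f != h by apply: contraNneq hX => <-.
  have := VC; rewrite -DN => /supportsP[W DW WV]; rewrite -{V}WV in VC gV fV hV sV.
  have orth S U : C U -> supp U \subset supp X :|: supp Y ->
      (forall x, x \in [set g; f; h] -> x \in supp U -> x \in S) ->
      supp U :&: supp W \subset S /\ orthogonal i U W.
    move=> CU sU inS.
    have sUW : supp U :&: supp W \subset [set g; f; h].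
      by apply: subset_trans sV; rewrite setIC setIS.
    split.
      by apply/subsetP => x xUW; apply: inS (subsetP sUW x xUW) _; case/setIP: xUW.
    apply: orth3 => //; apply: leq_trans (subset_leq_card sUW) _.
    by rewrite -setUA cardsU1 cards2; do 2![case: (_ \notin _) || case: (_ != _)].
  have [|/(orthogonal_set2 gf)[XW _] /XW Xgf] := orth [set g; f] X CX (subsetUl _ _).
    by move=> x /setUP[//|/set1P ->]; rewrite (negPf hX).
  have [|/(orthogonal_set2 gh)[YW _] /YW Ygh] := orth [set g; h] Y CY (subsetUr _ _).
    by move=> x; rewrite -setUA setUCA => /setUP[/set1P -> | //]; rewrite (negPf fY).
  have [||/(orthogonal_set3 gf gh fh)[ZW _] /ZW nullZ] := orth [set g; f; h] Z CZ.
  - by rewrite ZE.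
  - by [].
  by exists (fun x => i (W x)); split=> //; rewrite !bar_neq0 -!in_supp.
(* Taking [g] to be [e], where [Z] vanishes and [X] and [Y] are opposite, gives the same two-term
   relation for the values of [Z] at [f], [h] as for [X f], [Y h]. Agreement thus spreads from [f0]
   to all [h], then from [h0] to all [f]. *)
have ZXY f h : f \in supp X :\: supp Y -> h \in supp Y :\: supp X ->
    Z f = X f <-> Z h = Y h.
  move=> fXY hYX; have [v [[vf ve vh] Xv Yv]] := cocircuit f e h fXY hYX eXY.
  rewrite Ze mset0D => /to_semiring_null2 Zv.
  have {Yv} Xfh : X f * v f = - (Y h * v h).
    by rewrite -Yv -[X f * _]toppK -Xv XYe mulNt toppK.
  split=> ZE'.
    by apply: (tmulIr vh); apply: (inv_inj (@toppK T)); rewrite -Zv ZE' Xfh.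
  by apply: (tmulIr vf); rewrite Zv ZE' Xfh.
have Zh h : h \in supp Y :\: supp X -> Z h = Y h.
  by move=> hYX; apply/(ZXY f0).
have Zf f : f \in supp X :\: supp Y -> Z f = X f.
  by move=> fXY; apply/(ZXY f h0) => //; apply: Zh.
exists Z; split=> // g.
have [gX|gX] := boolP (g \in supp X); last first.
  have /eqP -> : X g == 0 by move: gX; rewrite in_supp negbK.
  rewrite mset0D; have [gY|gY] := boolP (g \in supp Y).
    by rewrite Zh ?in_setD ?gX //; apply/to_semiring_null2; rewrite toppK.
  have /eqP -> : Y g == 0 by move: gY; rewrite in_supp negbK.
  have /eqP -> : Z g == 0.
    rewrite -[_ == _]negbK -in_supp ZE; apply/negP => /(subsetP sZ0).
    by rewrite in_setU (negPf gX) (negPf gY).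
  by rewrite mset0D; apply: null0.
have [gY|gY] := boolP (g \in supp Y); last first.
  have /eqP -> : Y g == 0 by move: gY; rewrite in_supp negbK.
  by rewrite msetD0 Zf ?in_setD ?gY //; apply/to_semiring_null2; rewrite toppK.
have gXY : g \in supp X :&: supp Y by rewrite in_setI gX.
(* At a common element, the relation for [Z] becomes Z(g)v(g) - X(g)v(g) - Y(g)v(g); cancelling v(g)
   and changing signs gives (C4) at [g]. *)
have [v [[_ vg _] Xv Yv]] := cocircuit f0 g h0 f0XY h0YX gXY.
rewrite (Zf f0) // (Zh h0) // -[X f0 * _]toppK -Xv -[Y h0 * _]toppK -Yv => nullv.
have vgV : (v g)^-1 != 0 by rewrite tinv_neq0.
have eps0 : (Some (teps T) : T) != 0 by [].
have := null_lmul eps0 (null_rmul vgV nullv).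
rewrite -!/(topp _) !mulNt !toppK -!mulgA tmulV // !mulg1.
by rewrite -msetDA msetDC.
Qed.

End Vectors.

(** * The equivalence *)

Theorem theorem3p19 (T : skewTract) (i : involution T)
    (E : finType) (E_neq0 : 0 < #|E|) (N : matroid E)
    (C D : set {ffun E -> T})
    (hC : left_signature N C) (hD : right_signature (dual N) D) :
  (exists M : weakLeftMatroid T E,
     [/\ has_underlying_matroid M N, tcircuits M = C
       & tcocircuits i M N = D])
  <-> weak_dual_pair i N C D.
Proof.
have [C1 C2 C3 CN] := hC; split=> [[M [_ MC MD]]|[_ _ orth3]].
  split=> // X Y CX DY leXY.
  have XC : supp X \in circuits N by rewrite -CN; apply/supportsP; exists X.
  have YM : tcocircuits i M N Y by rewrite MD.
  have YC := YM.1; rewrite -MC in hC.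
  have orth2 Z e f : C Z -> e != f -> supp Z :&: supp Y = [set e; f] ->
      orthogonal i Z Y.
    by rewrite -MC => CZ; apply: tcocircuit_orthogonal2 YM.
  (* Cases on the size of the intersection: 0 gives the null sum, 1 is impossible, 2 is [orth2], and
     3 uses (C4). *)
  have [/eqP XY0|[e eXY]] := set_0Vmem (supp X :&: supp Y).
    have -> : orthogonal i X Y = null (dotprod i X Y) by [].
    rewrite (dotprod_setI i (S := set0)); last by rewrite (eqP XY0) subxx.
    by rewrite big_set0; apply: null0.
  have [f fXY] : exists f, f \in (supp X :&: supp Y) :\ e.
    apply/set0Pn; apply: contra (circuit_cocircuit_neq1 e XC YC) => /eqP XYe.
    by rewrite -(setD1K eXY) XYe setU0.
  have fe : e != f by move: fXY; rewrite in_setD1 eq_sym => /andP[].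
  have [XYef|[g gXY]] := set_0Vmem ((supp X :&: supp Y) :\ e :\ f).
    by apply: (orth2 X e f) => //; rewrite -(setD1K eXY) -(setD1K fXY) XYef setU0.
  move: (gXY); rewrite !in_setD1 => /and3P[gf ge _].
  apply: (axiomC4_orthogonal3 (e := e) (f := f) (g := g) hC) => //.
  - exact: tcircuitsC4.
  - by rewrite MC.
  - by rewrite MC.
  - by rewrite eq_sym.
  - by rewrite eq_sym.
  rewrite -(setD1K eXY) -(setD1K fXY) -(setD1K gXY).
  suff -> : (supp X :&: supp Y) :\ e :\ f :\ g = set0 by rewrite setU0 setUA.
  apply/eqP; rewrite -cards_eq0; move: leXY.
  by rewrite (cardsD1 e) eXY (cardsD1 f) fXY (cardsD1 g) gXY; case: #|_|.
have C4 := orthogonal3_axiomC4 hC hD orth3.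
pose M := WeakLeftMatroid C1 C2 C3 C4; exists M.
have sD : (D `<=` tcocircuits i M N)%classic.
  apply: (right_signature_sub_tcocircuits (M := M) hC hD) => X Y CX DY leXY.
  by apply: orth3 => //; apply: leqW.
by split=> //; apply/seteqP; split=> //; apply: tcocircuits_sub.
Qed.
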